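(* Let $X$ be a Hausdorff continuum with $w(X) < |X|$. Then $X$ is topologically reconstructible; that is, for every topological space $Y$ with $\mathcal{D}(Y)=\mathcal{D}(X)$, the space $Y$ is homeomorphic to $X$.
   Context: A Hausdorff continuum is a compact connected Hausdorff space. The weight $w(X)$ is the minimal cardinality of a base for the topology of $X$, and $|X|$ is the cardinality of $X$. For a topological space $X$, the deck is $\mathcal{D}(X)=\{[X\setminus\{x\}] : x\in X\}$, where $[Z]$ denotes the homeomorphism class of $Z$ and $X \setminus \{x\}$ carries the subspace topology (the deck is a set, without multiplicities). $X$ is topologically reconstructible if $\mathcal{D}(X)=\mathcal{D}(Y)$ implies $X\cong Y$ for every topological space $Y$. Standing convention: all spaces considered have at least three points. *)

(* Defs.v *)
From HB Require Import structures.
From mathcomp Require Import all_boot all_order all_algebra.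
From mathcomp Require Import all_classical all_reals all_analysis.

Set Implicit Arguments.
Unset Strict Implicit.
Unset Printing Implicit Defensive.

Local Open Scope classical_set_scope.
Local Open Scope card_scope.

Definition card_lt T U (A : set T) (B : set U) : Prop :=
  A #<= B /\ ~ (B #<= A).

Definition at_least_three_points (X : topologicalType) : Prop :=
  exists x y z : X, [/\ x <> y, y <> z & x <> z].

Definition hausdorff_continuum (X : topologicalType) : Prop :=
  [/\ compact [set: X], connected [set: X] & hausdorff_space X].

(* Cardinals are represented by sets up to [#=]: the weight of X is the
   cardinality of any minimum basis of X.  Such a basis exists by
   [minimum_basis_ex] below. *)
Definition minimum_basis (X : topologicalType) (B : set (set X)) : Prop :=
  basis B /\ forall C : set (set X), basis C -> B #<= C.

Lemma minimum_basis_ex (X : topologicalType) :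
  exists B : set (set X), minimum_basis B.
Proof.
pose P (A : set (set (set X) -> set X)) :=
  (forall f B, A f -> basis B -> B (f B)) /\
  (forall B f g, basis B -> A f -> A g -> f B = g B -> f = g).
have [F FP totF|A [[Amem Ainj] Amax]] := @Zorn_bigcup _ P.
  split=> [f B [A FA Af]|B f g bB [A FA Af] [A' FA' A'g] fg].
    by have [+ _] := FP _ FA; apply.
  have [AA'|A'A] := totF _ _ FA FA'.
  - by have [_ +] := FP _ FA' => /(_ B); apply => //; exact: AA'.
  - by have [_ +] := FP _ FA => /(_ B); apply => //; exact: A'A.
have [B bB hit] : exists2 B, basis B &
    forall b, B b -> exists2 f, A f & f B = b.
  apply: contrapT => noB.
  have miss B : exists b, basis B -> B b /\ forall f, A f -> f B <> b.
    have [bB|nbB] := pselect (basis B); last by exists set0.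
    apply: contrapT => nob; apply: noB; exists B => // b Bb.
    apply: contrapT => nof; apply: nob; exists b => _; split=> // f Af fb.
    by apply: nof; exists f.
  have [h hP] := choice miss.
  have bopen : basis (@open X).
    by split=> // x U; rewrite nbhsE => -[V [oV Vx] VU]; exists V.
  have AAh : A `<` A `|` [set h].
    split; first exact: subsetUl.
    move=> /(_ h (or_intror erefl)) Ah.
    by have [_ /(_ h Ah)] := hP _ bopen.
  apply: (Amax _ AAh); split=> [f B [Af|->] bB|B f g bB [Af|->] [Ag|->] //].
  - exact: (Amem f B Af bB).
  - by have [] := hP _ bB.
  - exact: (Ainj B).
  - by have [_ /(_ _ Af)] := hP _ bB.
  - by move=> e; have [_ /(_ _ Ag)] := hP _ bB; rewrite e.
exists B; split=> // C bC.
have /choice[s sP] b : exists f, B b -> A f /\ f B = b.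
  have [/hit[f Af fb]|nBb] := pselect (B b); first by exists f.
  by exists (fun=> set0).
have inj : {in B &, injective (fun b => s b C)}.
  move=> b b' /set_mem/sP[Ab eb] /set_mem/sP[Ab' eb'] e.
  by rewrite -eb -eb' (Ainj _ _ _ bC Ab Ab' e).
rewrite -(card_le_eql (inj_card_eq inj)); apply: subset_card_le.
by move=> _ [b /sP[Ab _] <-]; exact: (Amem _ C Ab bC).
Qed.

Definition weight_lt_card (X : topologicalType) : Prop :=
  exists2 B : set (set X), minimum_basis B & card_lt B [set: X].

Definition homeomorphic (X Y : topologicalType) : Prop :=
  exists (f : X -> Y) (g : Y -> X),
    [/\ continuous f, continuous g, cancel f g & cancel g f].

(* [set_type A] carries the topology induced by the inclusion, unlike
   [subspace A], whose carrier is the whole of X. *)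
Definition point_deleted (X : topologicalType) (x : X) : topologicalType :=
  set_type (~` [set x]).

(* [set topologicalType] is a universe inconsistency, so a class of spaces is
   a bare predicate and the deck a predicate on classes; boolp's extensionality
   axioms apply at this level, so [=] is equality of extensions. *)
Definition homeo_class (Z : topologicalType) : topologicalType -> Prop :=
  fun W => homeomorphic Z W.

Definition deck (X : topologicalType) : (topologicalType -> Prop) -> Prop :=
  fun C => exists x : X, C = homeo_class (point_deleted x).

Definition topologically_reconstructible (X : topologicalType) : Prop :=
  forall Y : topologicalType, at_least_three_points Y ->
    deck Y = deck X -> homeomorphic Y X.

(* Main.v *)
(* [Y] is Hausdorff because its cards are, and if [Y] is compact then [X] and
   [Y] are the one-point compactifications of a common card.  Suppose [Y] is
   not compact, and call the sides of a point [t] the disjoint open sets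
   clustering at [t] into which a punctured neighbourhood of [t] decomposes.
   If the cards at [x : X] and [y : Y] are homeomorphic, the end of [Y] at
   infinity gives [x] one more side than [y] has.  As [Y] has no isolated
   point, every point of [X] has two sides.  On the other hand, as in Moore's
   triod theorem, at most w(X) points of [X] have three sides: such a point is
   determined by finitely many basic open sets.  So some [x : X] lacks three
   sides, and then the corresponding [y : Y] lacks two.  But [y] survives in
   the card of [Y] at another point, hence is locally a point of [X], which
   has two sides: a contradiction. *)

Require Import Defs.
From HB Require Import structures.
From mathcomp Require Import all_boot all_order all_algebra.
From mathcomp Require Import all_classical all_reals all_analysis.

Set Implicit Arguments.
Unset Strict Implicit.
Unset Printing Implicit Defensive.

Local Open Scope classical_set_scope.
Local Open Scope card_scope.

(** * Finite sequences over an infinite type *)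

Definition inj_into (T : Type) (A B : set T) : Prop :=
  exists f : T -> T, (forall a, A a -> B (f a)) /\
    (forall a b, A a -> A b -> f a = f b -> a = b).

Lemma inj_into_total (T : Type) (A B : set T) : inj_into A B \/ inj_into B A.
Proof.
pose P (G : set (T * T)) := (forall u, G u -> A u.1 /\ B u.2) /\
  (forall u v, G u -> G v -> (u.1 = v.1 <-> u.2 = v.2)).
have [F FP totF|G [[GAB Ginj] Gmax]] := @Zorn_bigcup _ P.
  split=> [u [H FH Hu]|u v [H FH Hu] [K FK Kv]].
    by have [+ _] := FP _ FH; apply.
  have [HK|KH] := totF _ _ FH FK.
  - by have [_] := FP _ FK; apply => //; exact: HK.
  - by have [_] := FP _ FH; apply => //; exact: KH.
have [Gl|] := pselect (forall a, A a -> exists b, G (a, b)).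
  left; have /choice[f fP] a : exists b, A a -> G (a, b).
    have [/Gl[b Gab]|nAa] := pselect (A a); first by exists b.
    by exists a.
  exists f; split=> [a /fP/GAB[]//|a b /fP Ga /fP Gb fab].
  by apply/(Ginj _ _ Ga Gb).
move=> /existsNP[a /not_implyP[Aa nGa]].
right; have /choice[f fP] b : exists a, B b -> G (a, b).
  have [Bb|nBb] := pselect (B b); last by exists b.
  apply: contrapT => nGb; apply: (Gmax (G `|` [set (a, b)])).
    split; first exact: subsetUl.
    by move=> /(_ (a, b) (or_intror erefl)) Gab; apply: nGa; exists b.
  split=> [u [/GAB//|->//]|u v [Gu|->] [Gv|->]] //=.
  - exact: Ginj.
  - split=> e; exfalso.
      by apply: nGa; exists u.2; rewrite -e -surjective_pairing.
    by apply: nGb; exists u.1 => _; rewrite -e -surjective_pairing.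
  - split=> e; exfalso.
      by apply: nGa; exists v.2; rewrite e -surjective_pairing.
    by apply: nGb; exists v.1 => _; rewrite e -surjective_pairing.
exists f; split=> [b /fP/GAB[]//|a' b /fP Ga /fP Gb fab].
by apply/(Ginj _ _ Ga Gb).
Qed.

Definition pairing_dom (T : Type) (G : set ((T * T) * T)) : set T :=
  [set a | exists c, G ((a, a), c)].

(* [G] is the graph of an injection of [D * D] into [D] for
   [D = pairing_dom G]. *)
Definition pairing (T : Type) (G : set ((T * T) * T)) : Prop :=
  [/\ forall u v, G u -> G v -> (u.1 = v.1 <-> u.2 = v.2),
      forall u, G u ->
        [/\ pairing_dom G u.1.1, pairing_dom G u.1.2 & pairing_dom G u.2] &
      forall a b, pairing_dom G a -> pairing_dom G b -> exists c, G ((a, b), c)].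

Lemma pairing_dom_sub (T : Type) (G H : set ((T * T) * T)) :
  G `<=` H -> pairing_dom G `<=` pairing_dom H.
Proof. by move=> GH a [c /GH Hc]; exists c. Qed.

(** Each clause of [pairing] takes at most two elements of [G] as data, so it can be checked in a
    smaller pairing that contains both. This handles unions of chains. *)
Lemma pairing_directed (T : Type) (G : set ((T * T) * T)) :
  (forall u v, G u -> G v -> exists2 H, H `<=` G & [/\ pairing H, H u & H v]) ->
  pairing G.
Proof.
move=> dirG; split=> [u v Gu Gv|u Gu|a b [c Gc] [d Gd]].
- have [H HG [[injH _ _] Hu Hv]] := dirG u v Gu Gv; exact: injH.
- have [H HG [[_ domH _] Hu _]] := dirG u u Gu Gu.
  have [h1 h2 h3] := domH _ Hu.
  by split; apply: pairing_dom_sub HG _ _.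
- have [H HG [[_ _ totH] Hu Hv]] := dirG _ _ Gc Gd.
  have [e He] : exists e, H ((a, b), e) by apply: totH; [exists c|exists d].
  by exists e; exact: HG.
Qed.

Lemma pairing_nat (T : Type) (i : nat -> T) : injective i ->
  let G := [set u | exists m n : nat, u = ((i m, i n), i (pickle (m, n)))] in
  pairing G /\ forall n, pairing_dom G (i n).
Proof.
move=> injI /=; set G := [set u | _].
have domG n : pairing_dom G (i n) by exists (i (pickle (n, n))), n, n.
split=> //; split=> [_ _ [m [n ->]] [m' [n' ->]] /=|_ [m [n ->]]|a b].
- split=> [[/injI -> /injI ->]//|/injI e].
  by have [-> ->] := pcan_inj (@pickleK _) e.
- by split; exact: domG.
- move=> [c [m [n [-> _ _]]]] [d [m' [n' [-> _ _]]]].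
  by exists (i (pickle (m, m'))), m, m'.
Qed.

Lemma pairing_fun (T : Type) (G : set ((T * T) * T)) : pairing G ->
  exists p : T -> T -> T,
    (forall a b, pairing_dom G a -> pairing_dom G b -> G ((a, b), p a b)).
Proof.
move=> [_ _ totG].
have /choice[q qP] (u : T * T) : exists c,
    pairing_dom G u.1 -> pairing_dom G u.2 -> G (u, c).
  have [[D1 D2]|nD] := pselect (pairing_dom G u.1 /\ pairing_dom G u.2).
    by have [c Gc] := totG _ _ D1 D2; exists c; rewrite (surjective_pairing u).
  by exists u.1 => D1 D2; exfalso; exact: nD.
by exists (fun a b => q (a, b)) => a b Da Db; exact: (qP (a, b)).
Qed.

(** With [D] the domain and [e] the given injection, the pairing is extended to the union of [D] and
    its image under [e]; the three new blocks of pairs take their values in that image. *)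
Lemma pairing_extend (T : Type) (i : nat -> T) (G : set ((T * T) * T)) :
  injective i -> pairing G -> (forall n, pairing_dom G (i n)) ->
  inj_into (pairing_dom G) (~` pairing_dom G) ->
  exists2 H, G `<=` H & pairing H /\ exists u, H u /\ ~ G u.
Proof.
move=> injI pG iG [e [eD einj]]; have [p pP] := pairing_fun pG.
have [Ginj Gdom Gtot] := pG; set D := pairing_dom G in iG eD einj pP Gdom Gtot *.
have pD a b : D a -> D b -> D (p a b).
  by move=> Da Db; have [] := Gdom _ (pP _ _ Da Db).
have pinj a b c d : D a -> D b -> D c -> D d -> p a b = p c d -> a = c /\ b = d.
  move=> Da Db Dc Dd /(Ginj _ _ (pP _ _ Da Db) (pP _ _ Dc Dd)).2/=.
  by case.
pose sel (s : bool) a := if s then e a else a.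
have selinj s s' a b : D a -> D b -> sel s a = sel s' b -> s = s' /\ a = b.
  case: s; case: s' => //= Da Db E; [|exfalso..].
  - by split=> //; exact: einj.
  - by apply: (eD a); rewrite // E.
  - by apply: (eD b); rewrite // -E.
(* The index [s + s' * 2] tags the block of the pair, and the outer [e] keeps the new values apart
   from the old ones, which lie in [D]. *)
pose val (s s' : bool) a b := e (p (p a b) (i (s + s' * 2))).
have valinj s s' t t' a b c d : D a -> D b -> D c -> D d ->
    val s s' a b = val t t' c d -> [/\ s = t, s' = t', a = c & b = d].
  move=> Da Db Dc Dd.
  move=> /(einj _ _ (pD _ _ (pD _ _ Da Db) (iG _))
    (pD _ _ (pD _ _ Dc Dd) (iG _))) E.
  have [{}E /injI] := pinj _ _ _ _ (pD _ _ Da Db) (iG _) (pD _ _ Dc Dd) (iG _) E.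
  have [-> ->] := pinj _ _ _ _ Da Db Dc Dd E.
  by case: s; case: s'; case: t; case: t' {E}.
(* The condition [s || s'] leaves out the block [D * D], on which [G] is already total. *)
pose N : set ((T * T) * T) := [set u | exists s s' a b,
  [/\ s || s', D a, D b & u = ((sel s a, sel s' b), val s s' a b)]].
have domN s a : D a -> pairing_dom (G `|` N) (sel s a).
  case: s => [Da|]; last exact: pairing_dom_sub (@subsetUl _ _ _) _.
  by exists (val true true a a); right; exists true, true, a, a.
have domE x : pairing_dom (G `|` N) x -> exists2 sa : bool * T, D sa.2 & x = sel sa.1 sa.2.
  move=> [c [Gc|[s [s' [a [b [_ Da Db [-> _ _]]]]]]]].
    by exists (false, x) => //=; exists c.
  by exists (s, a).
exists (G `|` N); first exact: subsetUl.
split; last first.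
  exists ((sel true (i 0), sel true (i 0)), val true true (i 0) (i 0)); split.
    by right; exists true, true, (i 0), (i 0).
  by move=> /Gdom[/(eD _ (iG 0))].
have GN u v : G u -> N v -> (u.1 = v.1 <-> u.2 = v.2).
  move=> /Gdom[D1 D2 D3] [s [s' [a [b [ss Da Db ->]]]]] /=.
  split=> [E|E]; exfalso; last first.
    by rewrite E in D3; exact: (eD _ (pD _ _ (pD _ _ Da Db) (iG _)) D3).
  case: s s' ss E => [|] [|]//= _ E.
  - by apply: (eD a Da); rewrite E in D1.
  - by apply: (eD a Da); rewrite E in D1.
  - by apply: (eD b Db); rewrite E in D2.
split=> [u v [Gu|Nu] [Gv|Nv]|u [Gu|]|x y /domE[[s a]/= Da ->] /domE[[s' b]/= Db ->]].
- exact: Ginj.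
- exact: GN.
- by split=> [E|E]; apply/esym; apply/(GN v u).
- move: Nu Nv => [s [s' [a [b [ss Da Db ->]]]]] [t [t' [c [d [tt Dc Dd ->]]]]]/=.
  split=> [[]|].
    by move=> /selinj => /(_ Da Dc)[-> ->] /selinj => /(_ Db Dd)[-> ->].
  by move=> /valinj => /(_ Da Db Dc Dd)[-> -> -> ->].
- have [? ? ?] := Gdom _ Gu.
  by split; apply: pairing_dom_sub (@subsetUl _ _ _) _ _.
- move=> [s [s' [a [b [ss Da Db ->]]]]] /=; split; [exact: domN|exact: domN|].
  exact/(domN true)/pD/iG/pD.
- have [ss|nss] := boolP (s || s').
    by exists (val s s' a b); right; exists s, s', a, b.
  case: s s' nss => [|] [|]//= _; exists (p a b); left; exact: pP.
Qed.

(** The domain [D] of a maximal pairing cannot inject into its complement, so the complement injects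
    into [D]. Then [T] embeds in two copies of [D], and the pairing absorbs first the two copies and
    then the square. *)
Lemma square_inj (T : Type) (i : nat -> T) : injective i ->
  exists p : T * T -> T, injective p.
Proof.
move=> injI; have [] := pairing_nat injI; set G0 := [set u | _] => pG0 iG0.
(* The seed [G0] is added outside the members of the Zorn family, so that the union of the empty
   chain belongs to the family too. *)
have [F FP totF|G [pG Gmax]] := @Zorn_bigcup _ (fun G => pairing (G0 `|` G)).
  apply: pairing_directed => u v.
  have sub H : F H -> G0 `|` H `<=` G0 `|` \bigcup_(X in F) X.
    by move=> FH; apply: setUS => w Hw; exists H.
  move=> [Gu|[H FH Hu]] [Gv|[K FK Kv]].
  - by exists G0; [exact: subsetUl|split].
  - by exists (G0 `|` K); [exact: sub|split; [exact: FP|left|right]].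
  - by exists (G0 `|` H); [exact: sub|split; [exact: FP|right|left]].
  - have [HK|KH] := totF _ _ FH FK.
      by exists (G0 `|` K); [exact: sub|split; [exact: FP|right; apply: HK|right]].
    by exists (G0 `|` H); [exact: sub|split; [exact: FP|right|right; apply: KH]].
set M := G0 `|` G in pG.
have iM n : pairing_dom M (i n) by apply: pairing_dom_sub (iG0 n); exact: subsetUl.
have [DC|[e [eD einj]]] := inj_into_total (pairing_dom M) (~` pairing_dom M).
  exfalso; have [H MH [pH [u [Hu nMu]]]] := pairing_extend injI pG iM DC.
  apply: (Gmax H).
    split; first by apply: subset_trans MH; exact: subsetUr.
    by move=> /(_ _ Hu) Gu; apply: nMu; right.
  by rewrite (_ : G0 `|` H = H)//; apply/setUidPr; apply: subset_trans MH; exact: subsetUl.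
have [p pP] := pairing_fun pG; have [Minj Mdom _] := pG.
set D := pairing_dom M in iM eD einj pP Mdom *.
have pD a b : D a -> D b -> D (p a b).
  by move=> Da Db; have [] := Mdom _ (pP _ _ Da Db).
have pinj a b c d : D a -> D b -> D c -> D d -> p a b = p c d -> a = c /\ b = d.
  move=> Da Db Dc Dd /(Minj _ _ (pP _ _ Da Db) (pP _ _ Dc Dd)).2/=.
  by case.
have i01 : i 0 <> i 1 by move=> /injI.
pose h x := if pselect (D x) then p x (i 0) else p (e x) (i 1).
have hD x : D (h x).
  by rewrite /h; case: pselect => Dx; apply: pD => //; exact: eD.
have hinj x y : h x = h y -> x = y.
  rewrite /h; case: pselect => Dx; case: pselect => Dy.
  - by move=> /pinj[].
  - by move=> /pinj[]//; exact: eD.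
  - by move=> /pinj[]//; [exact: eD|move=> _ /esym].
  - by move=> /pinj[]//; [exact: eD|exact: eD|move=> + _; exact: einj].
exists (fun u => p (h u.1) (h u.2)) => -[a b] [c d] /= /pinj[]//.
by move=> /hinj -> /hinj ->.
Qed.

(** Iterated pairing codes the entries; the length is recorded as well, because the terminator [i 0]
    may itself be a value of [p]. *)
Lemma seq_inj (T : Type) (i : nat -> T) : injective i ->
  exists q : seq T -> T, injective q.
Proof.
move=> injI; have [p injP] := square_inj injI.
pose c := foldr (fun x y => p (x, y)) (i 0).
exists (fun s => p (i (size s), c s)) => s t /injP[/injI + +].
elim: s t => [[]//|x s IH [//|y t]] /= [sz] /injP[-> e].
by rewrite (IH t).
Qed.

(** * Homeomorphic cards as bijections continuous off one point *)

Lemma hausdorff_inj (X Y : topologicalType) (f : X -> Y) :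
  injective f -> continuous f -> hausdorff_space Y -> hausdorff_space X.
Proof.
move=> injf cf hY p q pq; apply: injf; apply: hY => A B fA fB.
by have [z [Az Bz]] := pq _ _ (cf p A fA) (cf q B fB); exists (f z).
Qed.

Lemma homeomorphic_hausdorff (X Y : topologicalType) :
  homeomorphic X Y -> hausdorff_space Y -> hausdorff_space X.
Proof. by move=> [f [g [cf _ fK _]]]; exact: hausdorff_inj (can_inj fK) cf. Qed.

Lemma point_deleted_hausdorff (X : topologicalType) (x : X) :
  hausdorff_space X -> hausdorff_space (point_deleted x).
Proof.
apply: (@hausdorff_inj _ _ (set_val : point_deleted x -> X)); first exact: val_inj.
exact: initial_continuous.
Qed.

Lemma open_complement_point (X : topologicalType) (x : X) :
  hausdorff_space X -> open (~` [set x]).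
Proof.
move=> hX; apply: closed_openC; apply: compact_closed hX _; exact: compact_set1.
Qed.

Lemma nbhs_neq (X : topologicalType) (x z : X) :
  hausdorff_space X -> z <> x -> nbhs z (~` [set x]).
Proof.
by move=> hX zx; apply: open_nbhs_nbhs; split=> //; exact: open_complement_point.
Qed.

(* Separating a and b in the complement of a third point c gives open sets
   meeting at most in c. *)
Lemma hausdorff_of_point_deleted (Y : topologicalType) :
  at_least_three_points Y ->
  (forall y : Y, hausdorff_space (point_deleted y)) -> hausdorff_space Y.
Proof.
move=> Y3 hY.
have third (a b : Y) : exists c, c <> a /\ c <> b.
  have [u [v [w [uv vw uw]]]] := Y3.
  have [ua|ua] := pselect (u = a); have [ub|ub] := pselect (u = b);
  have [va|va] := pselect (v = a); have [vb|vb] := pselect (v = b);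
  (try by exists u); (try by exists v); exists w; split; congruence.
have sep (a b : Y) : a <> b -> exists c U V, [/\ c <> a, c <> b,
    open U & open V] /\ [/\ U a, V b & forall z, U z -> V z -> z = c].
  move=> ab; have [c [ca cb]] := third a b; exists c.
  have a' : (~` [set c]) a by move=> /esym.
  have b' : (~` [set c]) b by move=> /esym.
  have := hY c; rewrite open_hausdorff.
  move=> /(_ (SigSub (mem_set a')) (SigSub (mem_set b'))).
  case=> [|[A B]/= [/set_mem/= Aa /set_mem/= Bb] [oA oB /eqP AB]].
    by apply/eqP => -[].
  move: oA oB => [U oU UA] [V oV VB]; exists U, V; split=> //.
  move: Aa Bb; rewrite -UA -VB; split=> // z Uz Vz; apply: contrapT => zc.
  have : (A `&` B) (SigSub (mem_set (zc : (~` [set c]) z))) by rewrite -UA -VB.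
  by rewrite AB.
have T1 (c a : Y) : a <> c -> exists U, [/\ open U, U a & ~ U c].
  move=> ac; have [d [U [V [[da dc oU oV] [Ua Vb UV]]]]] := sep _ _ ac.
  by exists U; split=> // Uc; apply: dc; rewrite (UV c).
have T1n (c a : Y) : a <> c -> nbhs a (~` [set c]).
  move=> /T1[U [oU Ua nUc]]; rewrite nbhsE; exists U => //.
  by move=> z Uz zc; apply: nUc; rewrite -zc.
move=> p q pq; apply: contrapT => /sep[c [U [V [[cp cq oU oV] [Up Vq UV]]]]].
(* As [c] differs from [p] and points are closed, removing [c] from [U] leaves a neighbourhood of
   [p], which must still meet [V]. *)
have [z [[Uz zc] Vz]] : (U `&` (~` [set c]) `&` V) !=set0.
  apply: pq; last exact: open_nbhs_nbhs.
  by apply: filterI; [exact: open_nbhs_nbhs|apply: T1n => /esym].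
by apply: zc; exact: UV.
Qed.

(** A homeomorphism of cards, completed by matching the two deleted points. Total maps avoid
    subtypes; no continuity is asked at [x] and [y]. *)
Definition punctured_homeo (X Y : topologicalType) (x : X) (y : Y)
    (f : X -> Y) (g : Y -> X) : Prop :=
  [/\ f x = y, cancel f g, cancel g f,
      forall z, z <> x -> {for z, continuous f} &
      forall w, w <> y -> {for w, continuous g}].

Lemma punctured_homeo_sym (X Y : topologicalType) (x : X) (y : Y) f g :
  punctured_homeo x y f g -> punctured_homeo y x g f.
Proof. by move=> [fx fK gK cf cg]; split=> //; rewrite -fx fK. Qed.

Definition extend_by (X Y : topologicalType) (x : X) (y : Y)
    (h : point_deleted x -> point_deleted y) (z : X) : Y :=
  if pselect ((~` [set x]) z) is left p then set_val (h (SigSub (mem_set p)))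
  else y.

Lemma extend_by_point (X Y : topologicalType) (x : X) (y : Y)
    (h : point_deleted x -> point_deleted y) : extend_by h x = y.
Proof. by rewrite /extend_by; case: pselect => // p; exfalso; exact: p. Qed.

Lemma extend_by_val (X Y : topologicalType) (x : X) (y : Y)
    (h : point_deleted x -> point_deleted y) (z : point_deleted x) :
  extend_by h (set_val z) = set_val (h z).
Proof.
rewrite /extend_by; case: pselect => [p|np].
  by congr (set_val (h _)); exact: val_inj.
by exfalso; apply: np; exact: set_valP.
Qed.

Lemma deleted_cases (X : topologicalType) (x z : X) :
  z = x \/ exists t : point_deleted x, z = set_val t.
Proof.
have [->|zx] := pselect (z = x); first by left.
by right; exists (SigSub (mem_set (zx : (~` [set x]) z))).
Qed.

Lemma extend_by_continuous (X Y : topologicalType) (x : X) (y : Y)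
    (h : point_deleted x -> point_deleted y) (z : X) :
  hausdorff_space X -> continuous h -> z <> x ->
  {for z, continuous (extend_by h)}.
Proof.
move=> hX ch zx; have [//|[t zt]] := deleted_cases x z.
rewrite zt => U; rewrite /= extend_by_val => Uhz.
have : nbhs (h t) (set_val @^-1` U).
  exact: (@initial_continuous _ _ (set_val : ~` [set y] -> Y) (h t) U Uhz).
move=> /(ch t) {Uhz}Uhz; have {Uhz} : nbhs t (h @^-1` (set_val @^-1` U)) by exact: Uhz.
rewrite nbhsE => -[_ [[W oW <-] Wt] WU].
have : nbhs (set_val t) (W `&` ~` [set x]).
  by apply: filterI; [exact: open_nbhs_nbhs|rewrite -zt; exact: nbhs_neq].
apply: filterS => u [Wu ux]; have [//|[v uv]] := deleted_cases x u.
by rewrite /= uv extend_by_val; apply: WU; rewrite /= -uv.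
Qed.

Lemma punctured_homeo_of_deleted (X Y : topologicalType) (x : X) (y : Y) :
  hausdorff_space X -> hausdorff_space Y ->
  homeomorphic (point_deleted x) (point_deleted y) ->
  exists f g, punctured_homeo x y f g.
Proof.
move=> hX hY [h [k [ch ck hK kK]]].
exists (extend_by h), (extend_by k); split.
- exact: extend_by_point.
- move=> z; have [->|[t ->]] := deleted_cases x z.
    by rewrite !extend_by_point.
  by rewrite !extend_by_val hK.
- move=> z; have [->|[t ->]] := deleted_cases y z.
    by rewrite !extend_by_point.
  by rewrite !extend_by_val kK.
- by move=> z zx; exact: extend_by_continuous.
- by move=> z zx; exact: extend_by_continuous.
Qed.

Lemma punctured_image_compact (X Y : topologicalType) (x : X) (y : Y) f g
    (C : set X) : punctured_homeo x y f g -> compact C -> ~ C x ->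
  compact (f @` C).
Proof.
move=> [_ _ _ cf _] cC Cx; apply: continuous_compact => //.
apply: continuous_in_subspaceT => z /set_mem Cz.
by apply: cf => zx; apply: Cx; rewrite -zx.
Qed.

Lemma image_cancel (T U : Type) (f : T -> U) (g : U -> T) (A : set T) :
  cancel f g -> cancel g f -> f @` A = g @^-1` A.
Proof.
move=> fK gK; apply/seteqP; split=> [_ [a Aa <-]|b Ab] /=; first by rewrite fK.
by exists (g b).
Qed.

Lemma punctured_preimage_closed (X Y : topologicalType) (x : X) (y : Y) f g
    (C : set X) : hausdorff_space Y -> punctured_homeo x y f g ->
  compact C -> ~ C x -> closed (g @^-1` C).
Proof.
move=> hY H cC Cx; have [_ fK gK _ _] := H.
rewrite -(image_cancel _ fK gK); apply: compact_closed hY _.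
exact: punctured_image_compact H cC Cx.
Qed.

Lemma punctured_preimage_open (X Y : topologicalType) (x : X) (y : Y) f g
    (C : set Y) : punctured_homeo x y f g -> open C -> ~ C y ->
  open (f @^-1` C).
Proof.
move=> [fx _ _ cf _] oC Cy; rewrite openE => z Cfz; rewrite /interior.
apply: cf; first by move=> zx; apply: Cy; rewrite -fx -zx.
exact: open_nbhs_nbhs.
Qed.

(** Only continuity at [x] is at stake. The complement of an open neighbourhood of [y] is compact
    and misses [y], so its preimage is compact, hence closed, and misses [x]. *)
Lemma punctured_homeo_compact (X Y : topologicalType) (x : X) (y : Y) f g :
  hausdorff_space X -> compact [set: Y] -> punctured_homeo x y f g ->
  continuous f.
Proof.
move=> hX cY H z; have [fx fK gK cf cg] := H.
have [->|zx] := pselect (z = x); last exact: cf.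
move=> U; rewrite /= fx => Uy.
have : closed (f @^-1` (~` U^°)).
  apply: (punctured_preimage_closed hX (punctured_homeo_sym H)).
    apply: subclosed_compact cY _ => //; apply: open_closedC; exact: open_interior.
  by apply.
rewrite -preimage_setC => /closed_openC; rewrite setCK => oU.
apply: (@filterS _ (nbhs x) _ (f @^-1` U^°)); last first.
  by apply: open_nbhs_nbhs; split=> //; rewrite /= fx.
by move=> u; exact: interior_subset.
Qed.

Lemma compact_homeomorphic (X Y : topologicalType) (x : X) (y : Y) f g :
  compact [set: X] -> hausdorff_space X -> compact [set: Y] -> hausdorff_space Y ->
  punctured_homeo x y f g -> homeomorphic X Y.
Proof.
move=> cX hX cY hY H; exists f, g; split.
- exact: punctured_homeo_compact hX cY H.
- exact: punctured_homeo_compact hY cX (punctured_homeo_sym H).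
- by have [] := H.
- by have [] := H.
Qed.

(** * Sides of a point *)

(* [I] indexes the sides of [t]. *)
Definition splits (I : Type) (T : topologicalType) (t : T) : Prop :=
  exists U : I -> set T,
  [/\ forall i, open (U i), forall i j z, U i z -> U j z -> i = j,
      forall i, ~ U i t, forall i, closure (U i) t &
      nbhs t [set z | z = t \/ exists i, U i z]].

(** Otherwise the closure of the preimage is a compact set missing [x], so its image is closed in
    [Y]; that image contains [S] but not [y]. *)
Lemma punctured_closure (X Y : topologicalType) (x : X) (y : Y) f g
    (S : set Y) :
  compact [set: X] -> hausdorff_space Y ->
  punctured_homeo x y f g -> closure S y -> ~ S y ->
  closure (f @^-1` S) x.
Proof.
move=> cX hY H Sy nSy; have [fx fK gK _ _] := H; apply: contrapT => Cx.
have cC : compact (closure (f @^-1` S)).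
  by apply: subclosed_compact cX _ => //; exact: closed_closure.
have := punctured_preimage_closed hY H cC Cx.
move=> /closure_id; set D := g @^-1` _ => DE.
apply: Cx; rewrite -(fK x) fx; change (D y); rewrite DE.
apply: closure_subset Sy => s Ss; apply: subset_closure.
by rewrite /= gK.
Qed.

(** Removing from [X] a small open neighbourhood of [x'] leaves a compact neighbourhood of [g y],
    which [f] carries over to [Y]. *)
Lemma punctured_compact_nbhs (X Y : topologicalType) (x' : X) (y' y : Y) f g :
  compact [set: X] -> hausdorff_space X -> punctured_homeo x' y' f g ->
  y <> y' -> exists2 N, compact N & nbhs y N.
Proof.
move=> cX hX H yy'; have [fx fK gK cf cg] := H.
have gyx : g y != x' by apply/eqP => gyx; apply: yy'; rewrite -fx -gyx gK.
have := hX; rewrite open_hausdorff => /(_ _ _ gyx).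
case=> -[A B]/= [/set_mem Ay /set_mem Bx] [oA oB /eqP/disjoints_subset AB].
exists (f @` (~` B)).
  apply: punctured_image_compact H _ _ => //.
  by apply: subclosed_compact cX _ => //; exact: open_closedC.
rewrite (image_cancel _ fK gK); apply: cg => //.
by apply: filterS AB _; exact: open_nbhs_nbhs.
Qed.

(* The new side of [x] is the image of the complement of a compact
   neighbourhood of [y]: it clusters at [x] as [Y] is not compact. *)
Lemma noncompact_splits (I : Type) (X Y : topologicalType) (x : X) (y : Y) f g
    (N : set Y) :
  compact [set: X] -> hausdorff_space X -> hausdorff_space Y ->
  ~ compact [set: Y] -> punctured_homeo x y f g ->
  compact N -> nbhs y N -> splits I y -> splits (option I) x.
Proof.
move=> cX hX hY ncY H cN Ny [U [oU dU nUy cU nbU]].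
have [fx fK gK cf cg] := H.
set W := [set z | _] in nbU.
(* Every point of [O] other than [y] lies in an old side, and [O] is disjoint from the complement of
   [N], whose preimage is the new side. *)
pose O := (N `&` W)^°.
have Oy : O y by apply: filterI.
have oO : open O by exact: open_interior.
have ON : O `<=` N by move=> z /interior_subset[].
have OW : O `<=` W by move=> z /interior_subset[].
have clN : closed N by exact: compact_closed.
exists (fun o => f @^-1` (if o is Some i then O `&` U i else ~` N)); split.
- case=> [i|]; apply: (punctured_preimage_open H).
  - exact: openI.
  - by move=> [_ /nUy].
  - exact: closed_openC.
  - by apply; exact: ON.
- move=> [i|] [j|]//= z.
  + by move=> [_ Ui] [_ Uj]; rewrite (dU _ _ _ Ui Uj).
  + by move=> [/ON].
  + by move=> nN [/ON].
- move=> [i|]; rewrite /= fx; first by move=> [_ /nUy].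
  by apply; exact: ON.
- move=> [i|].
    apply: (punctured_closure cX hY H); last by move=> [_ /nUy].
    move=> B By; have BO : nbhs y (B `&` O).
      by apply: filterI => //; exact: open_nbhs_nbhs.
    by have [z [Uz [Bz Oz]]] := cU i _ BO; exists z.
  apply: contrapT => Cx; apply: ncY.
  have cC : compact (closure (f @^-1` (~` N))).
    by apply: subclosed_compact cX _ => //; exact: closed_closure.
  have := compactU cN (punctured_image_compact H cC Cx).
  congr (compact _); apply/seteqP; split=> // z _.
  have [Nz|nNz] := pselect (N z); [by left|right].
  by exists (g z) => //; apply: subset_closure; rewrite /= gK.
(* The difference of [N] and [O] is compact and misses [y], so its preimage is closed and misses
   [x]; near [x], the values of [f] thus lie in [O] or outside [N]. *)
- have cNO : closed (f @^-1` (N `\` O)).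
    apply: (punctured_preimage_closed hX (punctured_homeo_sym H)).
      apply: subclosed_compact cN _; last by move=> z [].
      by rewrite setDE; apply: closedI => //; exact: open_closedC.
    by move=> [_]; exact.
  apply: (@filterS _ (nbhs x) _ (~` (f @^-1` (N `\` O)))); last first.
    apply: open_nbhs_nbhs; split; first exact: closed_openC.
    by rewrite /= fx => -[_]; exact.
  move=> z /= nNO; have [Nz|nNz] := pselect (N (f z)); last by right; exists None.
  have Oz : O (f z) by apply: contrapT => nO; apply: nNO.
  have [zy|[i Ui]] := OW _ Oz; last by right; exists (Some i).
  by left; rewrite -(fK z) zy -fx fK.
Qed.

(** Having sides is a local property, and [f] is a local homeomorphism away from [x]. Removing [x]
    from each side keeps its preimage under [g] open whatever [g] does at [y]. *)
Lemma punctured_splits (I : Type) (X Y : topologicalType) (x p : X) (y : Y) f g :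
  hausdorff_space X -> hausdorff_space Y -> punctured_homeo x y f g ->
  p <> x -> splits I p -> splits I (f p).
Proof.
move=> hX hY H px [U [oU dU nUp cU nbU]]; have [fx fK gK cf cg] := H.
have fpy : f p <> y by move=> fpy; apply: px; rewrite -(fK p) fpy -fx fK.
exists (fun i => g @^-1` (U i `&` ~` [set x])); split.
- move=> i; apply: (punctured_preimage_open (punctured_homeo_sym H)).
    by apply: openI => //; exact: open_complement_point.
  by move=> [_]; exact.
- by move=> i j z [Ui _] [Uj _]; exact: dU Ui Uj.
- by move=> i; rewrite /= fK => -[/nUp].
- move=> i W Wp; have : nbhs p (f @^-1` W `&` ~` [set x]).
    by apply: filterI; [exact: cf|exact: nbhs_neq].
  by move=> /(cU i)[z [Uz [Wz zx]]]; exists (f z); split; rewrite /= ?fK.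
- have nbg : nbhs (g (f p)) [set z | z = p \/ exists i, U i z] by rewrite fK.
  have Wp := cg _ fpy _ nbg.
  have : nbhs (f p) (g @^-1` [set z | z = p \/ exists i, U i z] `&` ~` [set y]).
    by apply: filterI; [exact: Wp|exact: nbhs_neq].
  apply: filterS => w [/= [gp|[i Ui]] wy]; first by left; rewrite -gp gK.
  by right; exists i; split=> // gx; apply: wy; rewrite -(gK w) gx fx.
Qed.

Lemma splits_unit (T : topologicalType) (t : T) :
  hausdorff_space T -> ~ open [set t] -> splits unit t.
Proof.
move=> hT nt; exists (fun=> ~` [set t]); split=> [_|[] []//|_|_|].
- exact: open_complement_point.
- by apply.
- apply: contrapT => nct; apply: nt.
  rewrite (_ : [set t] = ~` closure (~` [set t])).
    by apply: closed_openC; exact: closed_closure.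
  apply/seteqP; split=> [_ -> //|z ncz]; apply: contrapT => zt.
  by apply: ncz; exact: subset_closure.
- rewrite (_ : [set z | _] = setT); first exact: filterT.
  apply/seteqP; split=> // z _; have [->|zt] := pselect (z = t); first by left.
  by right; exists tt.
Qed.

(** * Points with three sides *)

Lemma basis_nbhs (X : topologicalType) (B : set (set X)) (x : X) (U : set X) :
  basis B -> nbhs x U -> exists b, [/\ B b, b x & b `<=` U].
Proof. by move=> [_ bB] /bB[b [Bb bx] bU]; exists b. Qed.

Lemma connected_clopen (X : topologicalType) (C : set X) :
  connected [set: X] -> open C -> closed C -> C !=set0 -> C = setT.
Proof.
move=> cX oC cC C0; apply: cX => //.
- by exists C => //; rewrite setTI.
- by exists C => //; rewrite setTI.
Qed.

(** Nested options match [noncompact_splits], which adds one [option] for the new side. *)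
Local Notation three := (option (option unit)).

(** This is why three sides are needed: given two points, one index avoids both the side of the
    first that contains the second and the side of the second that contains the first. *)
Lemma third_index (k j : three) : exists i, i <> k /\ i <> j.
Proof.
by case: k => [[[]|]|]; case: j => [[[]|]|];
  solve [by exists None | by exists (Some None) | by exists (Some (Some tt))].
Qed.

(** A global counterpart of [splits]: the pieces fill the whole complement of [x], not just a
    punctured neighbourhood. *)
Definition cut (X : topologicalType) (I : Type) (x : X) (P : I -> set X) : Prop :=
  [/\ forall i, open (P i), forall i, P i !=set0,
      forall i j z, P i z -> P j z -> i = j,
      forall i, ~ P i x & forall z, z <> x -> exists i, P i z].

Definition punctured_clopen (X : topologicalType) (x : X) (C : set X) : Prop :=
  [/\ open C, ~ C x & open (~` (x |` C))].

Lemma setC_punctured (X : Type) (x : X) (C : set X) :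
  ~ C x -> ~` (x |` ~` (x |` C)) = C.
Proof.
move=> Cx; apply/seteqP; split=> [z /not_orP[zx]|z Cz [zx|]].
- by move=> /contrapT[].
- by apply: Cx; rewrite -zx.
- by apply; right.
Qed.

Lemma punctured_clopenC (X : topologicalType) (x : X) (C : set X) :
  punctured_clopen x C -> punctured_clopen x (~` (x |` C)).
Proof.
by move=> [oC Cx oD]; split=> //; [apply; left|rewrite setC_punctured].
Qed.

Lemma cut_of_clopens (X : topologicalType) (x : X) (C E : set X) :
  punctured_clopen x C -> punctured_clopen x E ->
  C `&` E !=set0 -> C `&` ~` (x |` E) !=set0 -> ~` (x |` C) !=set0 ->
  exists P : three -> set X, cut x P.
Proof.
move=> [oC Cx oD] [oE Ex oE'] n1 n2 n3.
exists (fun i => match i with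
  | None => C `&` E | Some None => C `&` ~` (x |` E)
  | Some (Some _) => ~` (x |` C) end); split.
- by move=> [[_|]|]//; exact: openI.
- by move=> [[_|]|].
- move=> [[[]|]|] [[[]|]|]// z.
  + by move=> nC [Cz _]; exfalso; apply: nC; right.
  + by move=> nC [Cz _]; exfalso; apply: nC; right.
  + by move=> [Cz _] nC; exfalso; apply: nC; right.
  + by move=> [Cz nE] [_ Ez]; exfalso; apply: nE; right.
  + by move=> [Cz _] nC; exfalso; apply: nC; right.
  + by move=> [Cz Ez] [_ nE]; exfalso; apply: nE; right.
- by move=> [[_|]|]; [apply; left|move=> []|move=> []].
- move=> z zx; have [Cz|nCz] := pselect (C z); last first.
    by exists (Some (Some tt)) => -[].
  have [Ez|nEz] := pselect (E z); first by exists None.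
  by exists (Some None); split=> // -[].
Qed.

(** If the complement of [x] has no proper clopen part, [V] need only omit [a]. Otherwise it splits
    into two parts, containing [c] and [d]. A nonempty clopen part omitting [c] and [d] cuts one of
    these in two, which gives three pieces; if there is none, [V] omits [c] and [d]. *)
Lemma cut_or_no_small_clopen (X : topologicalType) (x a : X) :
  hausdorff_space X -> a <> x ->
  (exists P : three -> set X, cut x P) \/
  exists2 V, nbhs x V & forall C, punctured_clopen x C -> C `<=` V -> C = set0.
Proof.
move=> hX ax; have [[C [[pC [c Cc]] [d Dd]]]|noC] :=
    pselect (exists C, (punctured_clopen x C /\ C !=set0) /\ ~` (x |` C) !=set0).
  have [[E [[pE EV] [e Ee]]]|noE] := pselect (exists E,
      (punctured_clopen x E /\ E `<=` ~` [set c] `&` ~` [set d]) /\ E !=set0).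
    left; have [_ Cx _] := pC; have [_ Ex _] := pE.
    have Ec : ~ E c by move=> /EV[/(_ erefl)].
    have Ed : ~ E d by move=> /EV[_ /(_ erefl)].
    have [Ce|nCe] := pselect (C e).
      apply: (cut_of_clopens pC pE); [by exists e|exists c|by exists d].
      by split=> // -[cx|//]; apply: Cx; rewrite -cx.
    apply: (cut_of_clopens (punctured_clopenC pC) pE).
    - by exists e; split=> // -[ex|//]; apply: Ex; rewrite -ex.
    - by exists d; split=> // -[dx|//]; apply: Dd; left.
    - by exists c; rewrite setC_punctured.
  right; exists (~` [set c] `&` ~` [set d]).
    apply: filterI; apply: nbhs_neq => // e.
      by have [_ Cx _] := pC; apply: Cx; rewrite e.
    by apply: Dd; left.
  move=> E pE EV; apply: contrapT => /eqP/set0P E0; apply: noE; exists E.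
  by split.
right; exists (~` [set a]); first by apply: nbhs_neq => // /esym.
move=> C pC Ca; apply: contrapT => /eqP/set0P C0; apply: noC; exists C.
by split=> //; exists a => -[//|/Ca]; exact.
Qed.

Definition cut_code (X : topologicalType) (x : X) (b : three -> set X) : Prop :=
  exists P, cut x P /\ forall i, b i `<=` P i /\ b i !=set0.

(** If the points differ, choose [i] so that [P i] omits [x'] and [P' i] omits [x]. The complement
    of the intersection of [P i] and [P' i] is then the union of all other pieces, hence open; the
    intersection is clopen, nonempty because of [b i], and omits [x], against connectedness. *)
Lemma cut_code_inj (X : topologicalType) (x x' : X) (b : three -> set X) :
  connected [set: X] -> hausdorff_space X ->
  cut_code x b -> cut_code x' b -> x = x'.
Proof.
move=> cX hX [P [[oP _ dP Px Pcov] bP]] [P' [[oP' _ dP' Px' Pcov'] bP']].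
apply: contrapT => xx'.
have [k Pk] := Pcov x' (fun e => xx' (esym e)).
have [j Pj] := Pcov' x xx'.
have [i [ik ij]] := third_index k j.
have cPP : closed (P i `&` P' i).
  rewrite -[X in closed X]setCK; apply: open_closedC.
  rewrite (_ : ~` _ = (\bigcup_(l in [set l | l <> i]) P l) `|`
                     (\bigcup_(l in [set l | l <> i]) P' l)).
    by apply: openU; apply: bigcup_open.
  apply/seteqP; split=> [z nPP|z [] [l li Pl] [Pz P'z]]; last 2 first.
  - by apply: li; exact: dP Pl Pz.
  - by apply: li; exact: dP' Pl P'z.
  have [zx|zx] := pselect (z = x); first by right; exists j; [move=> /esym|rewrite zx].
  have [zx'|zx'] := pselect (z = x'); first by left; exists k; [move=> /esym|rewrite zx'].
  have [l Pl] := Pcov z zx; have [l' Pl'] := Pcov' z zx'.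
  have [li|li] := pselect (l = i); last by left; exists l.
  have [li'|li'] := pselect (l' = i); last by right; exists l'.
  by exfalso; apply: nPP; split; [rewrite -li|rewrite -li'].
have : (P i `&` P' i) x.
  rewrite (connected_clopen cX _ cPP)//; first exact: openI.
  have [biP [z bz]] := bP i; have [biP' _] := bP' i.
  by exists z; split; [exact: biP|exact: biP'].
by move=> [/Px].
Qed.

(* The code of a point [x] for which no nonempty set inside [V] is clopen off
   [x]; a point admitting arbitrarily small such sets cuts the continuum into
   three and is covered by [cut_code]. *)
Definition split_code (X : topologicalType) (x : X) (V : set X)
    (G : three -> set X) : Prop :=
  [/\ open V, V x, forall C, punctured_clopen x C -> C `<=` V -> C = set0 &
  exists U : three -> set X,
  [/\ forall i, open (U i) /\ ~ U i x, forall i j z, U i z -> U j z -> i = j,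
      forall i, closure (U i) x,
      closure V `<=` [set z | z = x \/ exists i, U i z] &
      forall i, closure V `&` U i `&` ~` V `<=` G i /\ G i `<=` U i]].

(* If the two points differ, some side [U i] of [x] avoids [x'] while the
   corresponding side [U' i] of [x'] avoids [x]; then the part of [V] lying in
   [U i] but not in [U' i] is clopen off [x], because both sides contain
   [G i], which covers the boundary of [V] within [U i]. *)
Lemma split_code_inj (X : topologicalType) (x x' : X) (V : set X)
    (G : three -> set X) :
  split_code x V G -> split_code x' V G -> x = x'.
Proof.
move=> [oV Vx noC [U [oU dU cU covU GU]]] [_ Vx' _ [U' [oU' dU' _ covU' GU']]].
apply: contrapT => xx'.
have [/esym//|[k Uk]] : x' = x \/ exists i, U i x'.
  by apply: covU; exact: subset_closure.
have [//|[j Uj]] : x = x' \/ exists i, U' i x.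
  by apply: covU'; exact: subset_closure.
have [i [ik ij]] := third_index k j.
pose Q := U i `&` V `&` ~` U' i.
have Q0 : Q = set0.
  apply: noC; last by move=> z [[]].
  split.
  - rewrite (_ : Q = U i `&` V `&` \bigcup_(l in [set l | l <> i]) U' l).
      apply: openI; last by apply: bigcup_open => l _; have [] := oU' l.
      by apply: openI => //; have [] := oU i.
    apply/seteqP; split=> z [[Uz Vz]]; last first.
      by move=> [l li Ul]; split=> // U'z; apply: li; exact: dU' Ul U'z.
    move=> nU'; split=> //; have [zx'|[l Ul]] := covU' z (subset_closure Vz).
      by exfalso; apply: ik; apply: dU Uz _; rewrite zx'.
    by exists l => // li; apply: nU'; rewrite -li.
  - by move=> [[Ux _] _]; have [_] := oU i; exact.
  - rewrite (_ : ~` _ = ~` closure V `|`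
      ((\bigcup_(l in [set l | l <> i]) U l) `|` U' i)).
      apply: openU; first by apply: closed_openC; exact: closed_closure.
      apply: openU; last by have [] := oU' i.
      by apply: bigcup_open => l _; have [] := oU l.
    apply/seteqP; split=> z.
      move=> nz; apply: contrapT => /not_orP[/contrapT Vz /not_orP[nUl nU']].
      apply: nz; have [->|[l Ul]] := covU z Vz; [by left|right].
      have li : l = i by apply: contrapT => li; apply: nUl; exists l.
      rewrite li in Ul; split=> //; split=> //; apply: contrapT => nV.
      by apply: nU'; apply: (GU' i).2; apply: (GU i).1.
    move=> H [zx|[[Uz Vz] nU'z]].
      case: H => [|[[l _ Ul]|U'z]].
      - by apply; rewrite zx; exact: subset_closure.
      - by have [_] := oU l; apply; rewrite -zx.
      - by apply: ij; apply: dU' U'z _; rewrite zx.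
    case: H => [|[[l li Ul]|//]]; first by apply; exact: subset_closure.
    by apply: li; exact: dU Ul Uz.
(* [Q] is nonempty after all: [U i] clusters at [x], and points near [x] lie in [V] and in [U' j],
   hence outside [U' i]. *)
have [|z [Uz [Vz U'z]]] := cU i (V `&` U' j).
  by apply: filterI; apply: open_nbhs_nbhs; split=> //; have [] := oU' j.
have : Q z by split=> // U'iz; apply: ij; exact: dU' U'iz U'z.
by rewrite Q0.
Qed.

(** * Codes built from finitely many basic open sets *)

Definition list_union (X : topologicalType) (B : set (set X))
    (s : seq (set_type B)) : set X :=
  foldr (fun b A => set_val b `|` A) set0 s.

Lemma list_union_cat (X : topologicalType) (B : set (set X))
    (s t : seq (set_type B)) :
  list_union (s ++ t) = list_union s `|` list_union t.
Proof. by elim: s => [|a s IH] /=; rewrite ?set0U// IH setUA. Qed.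

(** If no finite union works, the sets containing [F] minus a finite union of basic sets inside [U]
    form a proper filter. At a cluster point in [F], a basic neighbourhood inside [U] gives a
    contradiction. *)
Lemma compact_list_union (X : topologicalType) (B : set (set X)) (F U : set X) :
  basis B -> compact F -> F `<=` U -> open U ->
  exists s : seq (set_type B), F `<=` list_union s /\ list_union s `<=` U.
Proof.
move=> bB cF FU oU; apply: contrapT => noS.
pose H : set_system X := [set A | exists s : seq (set_type B),
  list_union s `<=` U /\ F `\` list_union s `<=` A].
have HF : ProperFilter H.
  apply: Build_ProperFilter_ex.
    move=> A [s [sU FsA]]; apply: contrapT => A0; apply: noS; exists s.
    split=> // z Fz; apply: contrapT => nsz; apply: A0; exists z; exact: FsA.
  split.
  - by exists [::]; split.
  - move=> A A' [s [sU FsA]] [t [tU FtA]]; exists (s ++ t).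
    rewrite list_union_cat; split; first by rewrite subUset.
    by move=> z [Fz /not_orP[ns nt]]; split; [exact: FsA|exact: FtA].
  - by move=> A A' AA' [s [sU FsA]]; exists s; split=> // z /FsA/AA'.
have [|z [Fz clz]] := cF H HF; first by exists [::]; split=> // z [].
have : nbhs z U by apply: open_nbhs_nbhs; split=> //; exact: FU.
move=> /(basis_nbhs bB)[b [Bb bz bU]].
have [||y [[Fy nby] by_]] := clz (F `\` b) b.
- exists [:: SigSub (mem_set Bb)] => /=.
  by rewrite setU0; split.
- by apply: open_nbhs_nbhs; split=> //; exact: bB.1.
- exact: nby.
Qed.

Lemma exists_cut_code (X : topologicalType) (B : set (set X)) (x : X)
    (P : three -> set X) : basis B -> cut x P ->
  exists b : three -> set_type B, cut_code x (fun i => set_val (b i)).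
Proof.
move=> bB cP; have [oP nP _ _ _] := cP.
have /choice[b bP] i : exists b : set_type B, set_val b `<=` P i /\ set_val b !=set0.
  have [z Pz] := nP i; have /(basis_nbhs bB)[b [Bb bz bU]] : nbhs z (P i).
    exact: open_nbhs_nbhs.
  by exists (SigSub (mem_set Bb)); split=> //; exists z.
by exists b, P.
Qed.

(** Regularity gives a basic [V] whose closure stays in [W] and within [x] and its sides. The
    boundary of [V] inside [U i] is [closure V] minus [V] and the other sides, hence compact, so
    finitely many basic sets inside [U i] cover it. *)
Lemma exists_split_code (X : topologicalType) (B : set (set X)) (x : X)
    (W : set X) : compact [set: X] -> hausdorff_space X -> basis B ->
  splits three x -> nbhs x W ->
  (forall C, punctured_clopen x C -> C `<=` W -> C = set0) ->
  exists (V : set_type B) (G : three -> seq (set_type B)),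
    split_code x (set_val V) (fun i => list_union (G i)).
Proof.
move=> cX hX bB [U [oU dU nUx cU nbU]] xW noC.
have [N xN NW] := compact_regular hX cX (@filterT _ (nbhs x) _) (filterI xW nbU).
have [V [BV Vx VN]] := basis_nbhs bB xN.
have clV : closure V `<=` W `&` [set z | z = x \/ exists i, U i z].
  by apply: subset_trans NW; exact: closure_subset.
have oV : open V by exact: bB.1.
have /choice[G GP] i : exists s : seq (set_type B),
    closure V `&` U i `&` ~` V `<=` list_union s /\ list_union s `<=` U i.
  apply: compact_list_union => //; last by move=> z [[]].
  apply: subclosed_compact cX _ => //.
  rewrite (_ : _ `&` _ = closure V `&` ~` (V `|` \bigcup_(l in [set l | l <> i]) U l)).
    apply: closedI; first exact: closed_closure.
    by apply: open_closedC; apply: openU => //; apply: bigcup_open.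
  apply/seteqP; split=> [z [[Vz Uz] nVz]|z [Vz /not_orP[nVz nUl]]].
    by split=> // -[//|[l li Ul]]; apply: li; exact: dU Ul Uz.
  split=> //; split=> //; have [_ [zx|[l Ul]]] := clV z Vz.
    by exfalso; apply: nVz; rewrite zx.
  have [<-//|li] := pselect (l = i).
  by exfalso; apply: nUl; exists l.
exists (SigSub (mem_set BV)), G; split=> //.
  move=> C pC CV; apply: noC => // z /CV Vz.
  by have [] := clV z (subset_closure Vz).
exists U; split=> // z Vz.
by have [] := clV z Vz.
Qed.

Lemma not_open_point (X : topologicalType) (x a : X) :
  connected [set: X] -> hausdorff_space X -> a <> x -> ~ open [set x].
Proof.
move=> cX hX ax ox; have xT : [set x] = setT.
  apply: (connected_clopen cX ox); last by exists x.
  by apply: compact_closed hX _; exact: compact_set1.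
by apply: ax; change ([set x] a); rewrite xT.
Qed.

(** In a finite basis, the members containing [x] would intersect in a neighbourhood of [x], reduced
    to [x] by separation; but [x] is not isolated. *)
Lemma infinite_basis (X : topologicalType) (B : set (set X)) (x a : X) :
  connected [set: X] -> hausdorff_space X -> a <> x -> basis B ->
  infinite_set B.
Proof.
move=> cX hX ax bB finB.
apply: (not_open_point cX hX ax).
rewrite openE => _ ->; rewrite /interior.
have /finite_fsetP[D DE] : finite_set (B `&` [set b | b x]).
  exact: finite_setIl.
have : nbhs x (\bigcap_(b in B `&` [set b | b x]) b).
  rewrite DE; apply: filter_bigI => b bD.
  have [Bb bx] : (B `&` [set b | b x]) b by rewrite DE.
  by apply: open_nbhs_nbhs; split=> //; exact: bB.1.
apply: filterS => z Dz; apply: contrapT => zx.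
have xz : x <> z by move=> xz; apply: zx; rewrite xz.
have [b [Bb bx bz]] := basis_nbhs bB (nbhs_neq hX xz).
by apply: (bz z (Dz b _)).
Qed.

(* A Hausdorff version of Moore's triod theorem. *)
Lemma card_le_basis_of_splits (X : topologicalType) (B : set (set X)) (u v : X) :
  hausdorff_continuum X -> u <> v -> basis B ->
  (forall x : X, splits three x) -> [set: X] #<= B.
Proof.
move=> [cX nX hX] uv bB sX.
have /infiniteP/pcard_leP[i] := infinite_basis nX hX uv bB.
pose j n : set_type B := SigSub (mem_set (@funS _ _ _ _ i n I)).
have jinj : injective j.
  by move=> m n /(congr1 set_val) /= e; apply: (@inj _ _ _ i); rewrite ?inE.
have [q qinj] := seq_inj jinj.
(* Cut codes have three entries and split codes four, so codes of different kinds never coincide. *)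
have /choice[c cP] (x : X) : exists s : seq (seq (set_type B)),
    (exists2 b : three -> set_type B, cut_code x (fun i => set_val (b i)) &
      s = [:: [:: b None]; [:: b (Some None)]; [:: b (Some (Some tt))]]) \/
    (exists V (G : three -> seq (set_type B)),
      split_code x (set_val V) (fun i => list_union (G i)) /\
      s = [:: [:: V]; G None; G (Some None); G (Some (Some tt))]).
  have [a ax] : exists a, a <> x.
    have [ux|] := pselect (u = x); last by exists u.
    by exists v => vx; apply: uv; rewrite ux.
  have [[P cP]|[W xW noC]] := cut_or_no_small_clopen hX ax.
    have [b bP] := exists_cut_code bB cP.
    by eexists; left; exists b.
  have [V [G VG]] := exists_split_code cX hX bB (sX x) xW noC.
  by eexists; right; exists V, G.
have cinj : injective c.
  move=> x y; have [[b cb ->]|[V [G [cVG ->]]]] := cP x;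
    have [[b' cb' ->]|[V' [G' [cVG' ->]]]] := cP y => //.
  - move=> [e0 e1 e2]; apply: cut_code_inj cb _ => //.
    by rewrite (_ : b = b')//; apply/funext => -[[[]|]|].
  - move=> [eV e0 e1 e2]; apply: split_code_inj cVG _.
    by rewrite eV (_ : G = G')//; apply/funext => -[[[]|]|].
(* [q] is applied first to each inner list and then to the resulting list, giving a single member of
   [B]. *)
pose h x : set X := set_val (q (map q (c x))).
have hinj : injective h.
  by move=> x y /val_inj/qinj/(inj_map qinj)/cinj.
have hin : {in [set: X] &, injective h} by move=> x y _ _; exact: hinj.
rewrite -(card_le_eql (inj_card_eq hin)); apply: subset_card_le.
by move=> _ [x _ <-]; exact: set_valP.
Qed.

(** * Reconstruction *)

Lemma homeomorphic_refl (X : topologicalType) : homeomorphic X X.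
Proof. by exists id, id; split=> // x U. Qed.

Lemma deck_homeomorphic (X Y : topologicalType) (x : X) :
  deck X = deck Y -> exists y : Y, homeomorphic (point_deleted x) (point_deleted y).
Proof.
move=> dXY; have : deck X (homeo_class (point_deleted x)) by exists x.
rewrite dXY => -[y xy]; exists y.
change (homeo_class (point_deleted x) (point_deleted y)); rewrite xy.
exact: homeomorphic_refl.
Qed.

Theorem theorem4p12 (X : topologicalType) (hX3 : at_least_three_points X)
    (hX : hausdorff_continuum X) (hw : weight_lt_card X) :
  topologically_reconstructible X.
Proof.
move=> Y Y3 dYX; have [cX nX sX] := hX.
have sY : hausdorff_space Y.
  apply: hausdorff_of_point_deleted => // y.
  have [x xy] := deck_homeomorphic y dYX.
  exact: homeomorphic_hausdorff xy (point_deleted_hausdorff sX).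
have fromX x : exists y f g, @punctured_homeo X Y x y f g.
  have [y xy] := deck_homeomorphic x (esym dYX).
  by exists y; exact: punctured_homeo_of_deleted.
have fromY y : exists x f g, @punctured_homeo X Y x y f g.
  have [x xy] := deck_homeomorphic y dYX.
  have [g [f H]] := punctured_homeo_of_deleted sY sX xy.
  by exists x, f, g; exact: punctured_homeo_sym.
have [u [v [_ [uv _ _]]]] := hX3.
have otherX x : exists a : X, a <> x.
  have [ux|] := pselect (u = x); last by exists u.
  by exists v => vx; apply: uv; rewrite ux.
have otherY y : exists a : Y, a <> y.
  have [w [z [_ [wz _ _]]]] := Y3.
  have [wy|] := pselect (w = y); last by exists w.
  by exists z => zy; apply: wz; rewrite wy.
have [cY|ncY] := pselect (compact [set: Y]).
  have [y [f [g H]]] := fromX u.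
  exact: compact_homeomorphic cY sY cX sX (punctured_homeo_sym H).
exfalso.
(* An isolated point of [Y] would survive in the card at another point and produce an isolated point
   of [X]. *)
have notisoY (y : Y) : ~ open [set y].
  move=> oy; have [y' /nesym yy'] := otherY y; have [x' [f [g H]]] := fromY y'.
  have [_ fK gK _ _] := H; have [a ag] := otherX (g y).
  apply: (not_open_point nX sX ag).
  rewrite (_ : [set g y] = f @^-1` [set y]).
    by apply: punctured_preimage_open H oy _ => /esym.
  by apply/seteqP; split=> [_ ->|z /= <-]; rewrite /= ?gK ?fK.
(* The card at [y] gives no compact neighbourhood of [y] itself; it is taken from the card at
   another point [y']. *)
have extra (I : Type) x y f g : @punctured_homeo X Y x y f g ->
    splits I y -> splits (option I) x.
  move=> H; have [y' /nesym yy'] := otherY y; have [x' [f' [g' H']]] := fromY y'.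
  have [N cN Ny] := punctured_compact_nbhs cX sX H' yy'.
  exact: (noncompact_splits cX sX sY ncY H cN Ny).
have two (x : X) : splits (option unit) x.
  have [y [f [g H]]] := fromX x.
  by apply: (extra _ _ _ _ _ H); exact: splits_unit.
have [x nx] : exists x : X, ~ splits three x.
  apply: contrapT => all3; have [B [bB _] [_]] := hw; apply.
  apply: card_le_basis_of_splits hX uv bB _ => x.
  by apply: contrapT => nx; apply: all3; exists x.
have [y [f [g H]]] := fromX x.
apply: nx; apply: (extra _ _ _ _ _ H).
(* In the card at another point [y'], the point [y] is the image under [f'] of [g' y], whose two
   sides it inherits. *)
have [y' /nesym yy'] := otherY y; have [x' [f' [g' H']]] := fromY y'.
have [fx' _ gK' _ _] := H'; rewrite -(gK' y).
apply: punctured_splits sX sY H' _ (two _) => gx'.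
by apply: yy'; rewrite -(gK' y) gx'.
Qed.
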